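(* Let $\vec\mu=(\mu_0,\mu_1,\dots,\mu_m)$ be a continuous standard vector of measures. Let $n$ be a nonnegative integer and let $P_n$ be a monic polynomial of degree $n$. Then $P_n$ is an $n$-th Sobolev minimal polynomial with respect to $\|\cdot\|_{1,\vec\mu}$ (that is, $\|P_n\|_{1,\vec\mu}\le\|Q\|_{1,\vec\mu}$ for every monic polynomial $Q$ of degree $n$) if and only if $$\sum_{k=0}^m\int_{\Delta_k} q^{(k)}\,\operatorname{sgn}\!\left(P_n^{(k)}\right)\,d\mu_k=0\qquad\text{for every polynomial } q \text{ of degree at most } n-1 .$$
   Context: Let $\mathbb{P}$ denote the space of all polynomials. A vector of measures $\vec\mu=(\mu_0,\dots,\mu_m)$, $m\ge 0$ an integer, consists of finite positive Borel measures $\mu_k$ with $\operatorname{supp}\mu_k\subset\mathbb{R}$ and $\mathbb{P}\subset L^1(\mu_k)$. It is called standard if $\operatorname{supp}\mu_0$ has infinitely many points, and continuous if $\mu_k(\{x\})=0$ for all $x\in\mathbb{R}$ and all $0\le k\le m$. $\Delta_k$ is the convex hull of $\operatorname{supp}\mu_k$. The norm on $\mathbb{P}$ is $$\|f\|_{1,\vec\mu}=\sum_{k=0}^m\int_{\Delta_k}|f^{(k)}|\,d\mu_k .$$ Here $\operatorname{sgn}(y)=y/|y|$ if $y\ne0$ and $\operatorname{sgn}(0)=0$. For $n=0$ the only polynomial of degree at most $-1$ is $0$. *)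

(* Defs.v *)
From mathcomp Require Import all_boot all_order all_algebra.
From mathcomp Require Import all_classical all_reals all_analysis.

Set Implicit Arguments.
Unset Strict Implicit.
Unset Printing Implicit Defensive.

Import Order.TTheory GRing.Theory Num.Theory.
Import numFieldNormedType.Exports.

Local Open Scope classical_set_scope.
Local Open Scope ring_scope.

Definition supp (R : realType) (mu : set (measurableTypeR R) -> \bar R) :
    set R :=
  [set x : R | forall U : set R, open U -> U x -> (0 < mu U)%E].

(* R^o is the line as a vector space over itself, the carrier on which
   convex_set is stated. *)
Definition convex_hull (R : realType) (A : set R) : set R :=
  smallest (@convex_set R R^o) A.

Section Sobolev.
Variables (R : realType) (m : nat).
(* The vector (mu_0, ..., mu_m) has m + 1 entries. *)
Variable mu : 'I_m.+1 -> {finite_measure set (measurableTypeR R) -> \bar R}.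

Definition polynomials_integrable :=
  forall (k : 'I_m.+1) (p : {poly R}),
    (mu k).-integrable setT (fun x : R => (p.[x])%:E).

Definition standard := infinite_set (supp (mu ord0)).

Definition continuous_measures :=
  forall (k : 'I_m.+1) (x : R), mu k [set x] = 0%E.

Definition Delta (k : 'I_m.+1) : set R := convex_hull (supp (mu k)).

(* Real-valued integrals are faithful here because the integrands are
   integrable under polynomials_integrable; otherwise infinite values would
   be collapsed to 0. *)
Definition sobolev_norm1 (f : {poly R}) : R :=
  \sum_(k < m.+1) \int[mu k]_(x in Delta k) `|f^`(k).[x]|.

(* size p is the degree plus one for p != 0. *)
Definition monic_of_degree (n : nat) (p : {poly R}) :=
  p \is monic /\ size p = n.+1.

Definition sobolev_minimal (n : nat) (P : {poly R}) :=
  monic_of_degree n P /\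
  forall Q : {poly R},
    monic_of_degree n Q -> sobolev_norm1 P <= sobolev_norm1 Q.

End Sobolev.

(* Main.v *)
Require Import Defs.
From mathcomp Require Import all_boot all_order all_algebra.
From mathcomp Require Import all_classical all_reals all_analysis.
From mathcomp Require Import measurable_realfun.
From mathcomp Require Import ring lra.
Import Order.TTheory GRing.Theory Num.Theory.
Import numFieldNormedType.Exports.
Local Open Scope classical_set_scope.
Local Open Scope ring_scope.

(** A polynomial [P] of degree [n] minimizes the norm iff [0] minimizes each of
    the convex functions [t |-> ||P + t q||] with [deg q < n].  Their derivative
    at [0] is the sum of the integrals of [q^(k) sgn P^(k)]: by dominated
    convergence the integral of [|f + t h|] has derivative [int h sgn f] at
    [t = 0] as soon as [h] vanishes almost everywhere on the zero set of [f].
    For [f = P^(k)] and [h = q^(k)], either [k <= n] and the zero set is finite,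
    hence null, or [k > n] and [h = 0].  Conversely orthogonality gives
    [||P|| = sum int Q^(k) sgn P^(k) <= ||Q||]. *)

(** A point between [x] and [y] is a convex combination of them, hence lies in every convex set
    containing [A]. This makes each [Delta] an interval, and so measurable. *)
Lemma is_interval_convex_hull (R : realType) (A : set R) :
  is_interval (convex_hull A).
Proof.
move=> x y xA yA z /andP[xz zy] B [cB AB].
have xB : x \in B by rewrite inE; apply: xA.
have yB : y \in B by rewrite inE; apply: yA.
have [xy|yx] := ltP x y; last first.
  by have -> : z = x; [lra | exact/set_mem].
have t0 : 0 <= (y - z) / (y - x) by apply: divr_ge0; lra.
have t1 : (y - z) / (y - x) <= 1 by rewrite ler_pdivrMr; lra.
(* The weight of [x] in [z] is packaged as an element of the unit interval type over which
   [convex_set] quantifies. *)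
have t01 : Itv.spec (@Itv.num_sem R) (Itv.Real `[0%Z, 1%Z])
    ((y - z) / (y - x)).
  by rewrite /= /Itv.num_sem/= num_real/= in_itv/= t0 t1.
have e : (y - z) / (y - x) * x + (1 - (y - z) / (y - x)) * y = z.
  by field; lra.
by rewrite -e; exact: set_mem (cB x y (Itv.mk t01) xB yB).
Qed.

Lemma measurable_sgr (R : realType) (D : set R) :
  measurable_fun D (Num.sg : R -> R).
Proof.
apply: measurable_funTS.
have -> : (Num.sg : R -> R) = (fun x => \1_(`]0, +oo[) x - \1_(`]-oo, 0[) x).
  apply/funext => x; rewrite !indicE !mem_setE !in_itv/= andbT.
  case: (ltrgtP x 0) => [x0|x0|->]; last by rewrite sgr0 subrr.
    by rewrite ltr0_sg// sub0r.
  by rewrite gtr0_sg// subr0.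
apply: measurable_funB; apply: measurable_indic; exact: measurable_itv.
Qed.

Section derivative_of_the_L1_norm.
Context {d} {T : measurableType d} {R : realType}.
Variables (mu : {measure set T -> \bar R}) (D : set T).
Hypothesis mD : measurable D.
Implicit Types f h : T -> R.

Lemma integrable_mul_sgr {f h} : measurable_fun D f ->
  mu.-integrable D (EFin \o h) ->
  mu.-integrable D (EFin \o (fun x => h x * Num.sg (f x))).
Proof.
move=> mf ih; apply: le_integrable (ih) => //.
  apply/measurable_EFinP/measurable_funM.
    exact/measurable_EFinP/(measurable_int mu).
  by apply: measurableT_comp => //; exact: measurable_sgr.
move=> x _ /=; rewrite lee_fin normrM normr_sg ler_piMr//.
by case: eqP => /=; rewrite ?ler01.
Qed.

(** For [a != 0] the sequence is eventually constant: once [n.+1] exceeds [|b| / |a|], adding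
    [b / n.+1] to [a] cannot reverse its sign, and the absolute values open up. For [a = 0] the
    quotient is [|b|] while the limit is [0], whence the hypothesis. *)
Lemma cvg_normr_diff_quotient (a b : R) : (a = 0 -> b = 0) ->
  n.+1%:R * (`|a + n.+1%:R^-1 * b| - `|a|) @[n --> \oo] --> b * Num.sg a.
Proof.
have [-> /(_ erefl) ->|a0 _] := eqVneq a 0.
  apply: cvg_near_cst; apply: nearW => n.
  by rewrite mulr0 addr0 subrr !(mulr0, mul0r).
apply: cvg_near_cst; near=> n.
have n0 : (0 : R) < n.+1%:R by rewrite ltr0n.
have ban : `|b| <= `|a| * n.+1%:R.
  rewrite -ler_pdivrMl ?normr_gt0// mulrC.
  apply: (@le_trans _ _ n%:R); last by rewrite ler_nat.
  by near: n; exact: nbhs_infty_ger.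
have ban' : `|n.+1%:R^-1 * b| <= `|a|.
  by rewrite normrM ger0_norm ?invr_ge0 ?ler0n// ler_pdivrMl// mulrC.
have e : n.+1%:R * (n.+1%:R^-1 * b) = b.
  by rewrite mulrA mulfV ?mul1r// gt_eqF.
move: ban' e; rewrite ler_norml; set u := _^-1 * b => /[swap] e.
have [a1|a1|a1] := ltrgtP a 0; last by rewrite a1 eqxx in a0.
  rewrite ltr0_norm// ltr0_sg// => /andP[_ ub].
  rewrite ler0_norm; last lra.
  by rewrite -[in RHS]e; ring.
rewrite gtr0_norm// gtr0_sg// => /andP[lb _].
rewrite ger0_norm; last lra.
by rewrite -[in RHS]e; ring.
Unshelve. all: by end_near. Qed.

Lemma cvg_L1_diff_quotient {f h} :
  mu.-integrable D (EFin \o f) -> mu.-integrable D (EFin \o h) ->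
  {ae mu, forall x, D x -> f x = 0 -> h x = 0} ->
  n.+1%:R * (\int[mu]_(x in D) `|f x + n.+1%:R^-1 * h x| -
             \int[mu]_(x in D) `|f x|) @[n --> \oo] -->
  \int[mu]_(x in D) (h x * Num.sg (f x)).
Proof.
move=> if_ ih fh.
pose g n x := n.+1%:R * (`|f x + n.+1%:R^-1 * h x| - `|f x|).
have ifh n : mu.-integrable D (EFin \o (fun x => f x + n.+1%:R^-1 * h x)).
  exact: (integrableD mD if_ (integrableZl mD n.+1%:R^-1 ih)).
have igB n : mu.-integrable D
    (EFin \o (fun x => `|f x + n.+1%:R^-1 * h x| - `|f x|)).
  exact: (integrableB mD (integrable_norm (ifh n)) (integrable_norm if_)).
have ig n : mu.-integrable D (EFin \o g n) by exact: integrableZl (igB n).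
have gE n : n.+1%:R * (\int[mu]_(x in D) `|f x + n.+1%:R^-1 * h x| -
             \int[mu]_(x in D) `|f x|) = \int[mu]_(x in D) g n x.
  by rewrite RintegralZl// RintegralB//; exact: integrable_norm.
under eq_fun do rewrite gE.
have mf : measurable_fun D f by exact/measurable_EFinP/(measurable_int mu).
have is_ := integrable_mul_sgr mf ih.
apply: fine_cvg; rewrite fineK; last exact: integrable_fin_num.
have [] // := @dominated_convergence _ _ _ mu D mD (fun n => EFin \o g n)
  (EFin \o (fun x => h x * Num.sg (f x))) (EFin \o (fun x => `|h x|)).
- by move=> n; exact: (measurable_int mu).
- exact: (measurable_int mu).
- apply: filterS fh => x fh Dx; apply: cvg_EFin; first exact: nearW.
  exact: cvg_normr_diff_quotient (fh Dx).
- exact: integrable_norm.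
(* The reverse triangle inequality bounds every quotient by [|h x|], uniformly in [n]. *)
- apply: aeW => x n _ /=; rewrite lee_fin /g normrM ger0_norm ?ler0n//.
  rewrite -ler_pdivlMl ?ltr0n//.
  apply: (le_trans (ler_dist_dist _ _)).
  by rewrite addrC addKr normrM ger0_norm// invr_ge0 ler0n.
Qed.

End derivative_of_the_L1_norm.

(** Induction on the degree: each root splits off a linear factor and contributes only a null
    singleton. *)
Lemma ae_neq0_horner {R : realType}
    {mu : {measure set (measurableTypeR R) -> \bar R}} {p : {poly R}} :
  (forall x : R, mu [set x] = 0%E) -> p != 0 ->
  {ae mu, forall x, p.[x] != 0}.
Proof.
move=> mu1; have [n] := ubnP (size p); elim: n p => // n IHn p sp p0.
have [[a /factor_theorem[q pE]]|noroot] := pselect (exists a, root p a);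
  last by apply: aeW => x; apply/negP => px; apply: noroot; exists x.
have q0 : q != 0 by apply: contraNneq p0 => q0; rewrite pE q0 mul0r.
have ae_a : {ae mu, forall x, x != a}.
  exists [set a]; split => //=.
  by move=> x /= /negP; rewrite negbK => /eqP.
have ae_q : {ae mu, forall x, q.[x] != 0}.
  apply: IHn => //.
  by move: sp; rewrite pE size_Mmonic ?monicXsubC// size_XsubC addn2.
have := ae_filter_ringOfSetsType mu => ae_filter.
apply: filterS2 ae_a ae_q => x xa qx.
by rewrite pE hornerM mulf_neq0// hornerXsubC subr_eq0.
Qed.

Lemma derivn_neq0 {R : numDomainType} {p : {poly R}} {k} :
  (k < size p)%N -> p^`(k) != 0.
Proof.
case sp : (size p) => [//|s]; rewrite ltnS => ks.
have ps : p`_s != 0.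
  by rewrite -[s]/s.+1.-1 -sp -lead_coefE lead_coef_eq0 -size_poly_gt0 sp.
(* This coefficient of the derivative is the leading coefficient of [p] times the falling factorial
   [s ^_ k], both nonzero in characteristic zero. *)
apply/eqP => /(congr1 (fun q : {poly R} => q`_(s - k))).
rewrite coef_derivn subnKC// coef0 => /eqP.
by rewrite mulrn_eq0 (negPf ps) orbF -leqn0 leqNgt ffact_gt0 ks.
Qed.

(** Together with [size_monic_of_degreeB], this identifies the competitors of [P] with its
    perturbations by polynomials of degree less than [n]. *)
Lemma monic_of_degreeD {R : realType} {n} {P q : {poly R}} :
  monic_of_degree n P -> (size q <= n)%N -> monic_of_degree n (P + q).
Proof.
move=> [Pm sP] sq; split; last by rewrite size_polyDl sP.
by rewrite monicE lead_coefDl ?sP// -monicE.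
Qed.

Lemma size_monic_of_degreeB {R : realType} {n} {P Q : {poly R}} :
  monic_of_degree n P -> monic_of_degree n Q -> (size (Q - P)%R <= n)%N.
Proof.
move=> [/monicP Pm sP] [/monicP Qm sQ]; apply/leq_sizeP => j.
rewrite leq_eqVlt coefB => /predU1P[<-|nj].
  move: Pm Qm; rewrite !lead_coefE sP sQ /= => -> ->.
  by rewrite subrr.
by rewrite !nth_default ?sP ?sQ ?subrr.
Qed.

Section orthogonality.
Context {R : realType} {m : nat}.
Variable mu : 'I_m.+1 -> {finite_measure set (measurableTypeR R) -> \bar R}.
Hypothesis mu_L1 : polynomials_integrable mu.

Let measurable_Delta k : measurable (Delta mu k : set (measurableTypeR R)).
Proof. by apply: is_interval_measurable; exact: is_interval_convex_hull. Qed.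

Let integrable_horner k (p : {poly R}) :
  (mu k).-integrable (Delta mu k) (EFin \o horner p).
Proof. exact: integrableS (mu_L1 k p). Qed.

(** The directional derivative of the norm at [P] along [q], when [q] has smaller degree and the
    measures are continuous. It is additive in [q] but not in [P]. *)
Definition sign_pairing (P q : {poly R}) : R :=
  \sum_(k < m.+1)
    \int[mu k]_(x in Delta mu k) (q^`(k).[x] * Num.sg (P^`(k).[x])).

Let integrable_pairing k (P q : {poly R}) :
  (mu k).-integrable (Delta mu k)
    (EFin \o (fun x => q.[x] * Num.sg P.[x])).
Proof.
apply: (@integrable_mul_sgr _ _ _ _ _ (measurable_Delta k) (horner P)).
  by apply/measurable_EFinP; apply: (measurable_int (mu k)).
exact: integrable_horner.
Qed.

Lemma sign_pairingD P q r :
  sign_pairing P (q + r) = sign_pairing P q + sign_pairing P r.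
Proof.
rewrite -big_split; apply: eq_bigr => k _ /=.
rewrite -RintegralD; [|exact: measurable_Delta|exact: integrable_pairing..].
apply: eq_Rintegral => x _.
by rewrite derivnD hornerD mulrDl.
Qed.

Lemma sign_pairingN P q : sign_pairing P (- q) = - sign_pairing P q.
Proof.
apply/eqP; rewrite -addr_eq0 -sign_pairingD addNr; apply/eqP.
apply: big1 => k _; rewrite linear0.
by under eq_Rintegral do rewrite horner0 mul0r; rewrite Rintegral_cst// mul0r.
Qed.

(** Since [y * Num.sg y = |y|], the bound of [le_sign_pairing_norm] is attained at [q = P]. *)
Lemma sobolev_norm1_pairing P : sobolev_norm1 mu P = sign_pairing P P.
Proof.
apply: eq_bigr => k _; apply: eq_Rintegral => x _.
by rewrite mulrC -normrEsg.
Qed.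

Lemma le_sign_pairing_norm P q : sign_pairing P q <= sobolev_norm1 mu q.
Proof.
apply: ler_sum => k _; apply: le_Rintegral.
- exact: measurable_Delta.
- exact: integrable_pairing.
- exact: integrable_norm (integrable_horner k _).
move=> x _; rewrite (le_trans (ler_norm _))// normrM normr_sg ler_piMr//.
by case: eqP => /=; rewrite ?ler01.
Qed.

Lemma cvg_sobolev_diff_quotient {n} {P q : {poly R}} :
  continuous_measures mu -> size P = n.+1 -> (size q <= n)%N ->
  i.+1%:R * (sobolev_norm1 mu (P + i.+1%:R^-1 *: q) - sobolev_norm1 mu P)
    @[i --> \oo] --> sign_pairing P q.
Proof.
move=> mu0 sP sq; rewrite /sobolev_norm1.
under eq_cvg do rewrite -sumrB mulr_sumr.
apply: cvg_big => [|k _]; first exact: add_continuous.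
under eq_cvg => i.
  under eq_Rintegral do rewrite derivnD derivnZ hornerD hornerZ.
  over.
apply: (@cvg_L1_diff_quotient _ _ _ (mu k)).
- exact: measurable_Delta.
- exact: integrable_horner.
- exact: integrable_horner.
(* Beyond order [n] the derivative of [P] vanishes identically, so its zero set need not be null;
   there the derivative of [q] vanishes too. *)
have [nk|kn] := ltnP n k.
  by apply: aeW => x _ _; rewrite derivn_poly0 ?horner0// (leq_trans sq)// ltnW.
have Pk0 : P^`(k) != 0 by rewrite derivn_neq0// sP ltnS.
have := ae_filter_ringOfSetsType (mu k) => ae_filter.
by apply: filterS (ae_neq0_horner (mu0 k) Pk0) => x /eqP.
Qed.

End orthogonality.

Theorem theorem2p2 (R : realType) (m : nat)
    (mu : 'I_m.+1 -> {finite_measure set (measurableTypeR R) -> \bar R})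
    (mu_L1 : polynomials_integrable mu)
    (mu_standard : standard mu)
    (mu_continuous : continuous_measures mu)
    (n : nat) (P : {poly R}) (P_monic : monic_of_degree n P) :
  sobolev_minimal mu n P <->
  (forall q : {poly R}, (size q <= n)%N ->
     \sum_(k < m.+1)
       \int[mu k]_(x in Delta mu k) (q^`(k).[x] * Num.sg (P^`(k).[x])) = 0).
Proof.
change (sobolev_minimal mu n P <->
  forall q : {poly R}, (size q <= n)%N -> sign_pairing mu P q = 0).
split=> [[_ Pmin]|P_orth].
  (* Minimality makes every difference quotient with positive increment nonnegative, and so is the
     limit. Positive increments suffice, because [- q] is an admissible direction as well and gives
     the opposite inequality. *)
  have pairing_ge0 (q : {poly R}) : (size q <= n)%N -> 0 <= sign_pairing mu P q.
    move=> sq.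
    apply: (closed_cvg (fun y : R => 0 <= y)) _ _ _
      (cvg_sobolev_diff_quotient mu mu_L1 mu_continuous P_monic.2 sq).
      exact: closed_ge.
    apply: nearW => i /=; rewrite mulr_ge0 ?ler0n// subr_ge0; apply: Pmin.
    by apply: monic_of_degreeD; rewrite // (leq_trans (size_scale_leq _ _)).
  move=> q sq; apply/eqP; rewrite eq_le pairing_ge0// andbT.
  by rewrite -oppr_ge0 -sign_pairingN// pairing_ge0// size_polyN.
split=> // Q Q_monic; rewrite sobolev_norm1_pairing.
(* Orthogonality to [Q - P] lets [Q] replace [P] in the second argument of the pairing. *)
have := P_orth _ (size_monic_of_degreeB P_monic Q_monic).
rewrite sign_pairingD// sign_pairingN// => /subr0_eq <-.
exact: le_sign_pairing_norm.
Qed.
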